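(* Let $X$ be a locally compact non-separable metrizable space and let $X=\bigoplus_{i\in I}X_i$ (topological direct sum), where each $X_i$ is a separable non-compact subspace. Then: (1) If at most countably many of the $X_i$'s are non-discrete, then for every non-empty $Z\in\mathcal{Z}(X^* )$ we have $Z\in\lambda(\mathcal{E}(X))$ if and only if $\mathrm{int}_{c\sigma X}(Z\setminus\sigma X)=\emptyset$. (2) If uncountably many of the $X_i$'s are non-discrete, then there exists a non-empty $Z\in\mathcal{Z}(X^* )$ such that $\mathrm{int}_{c\sigma X}(Z\setminus\sigma X)=\emptyset$ but $Z\notin\lambda(\mathcal{E}(X))$.
   Context: For a non-compact metrizable space $X$, $\mathcal{E}(X)$ denotes the set of all one-point metrizable extensions of $X$, i.e. metrizable spaces $Y=X\cup\{p\}$ with $p\notin X$ containing $X$ as a dense subspace, where two such extensions are identified if there is a homeomorphism between them fixing $X$ pointwise. $\beta X$ is the Stone-Čech compactification of $X$; for $A\subseteq X$, $A^*=(\mathrm{cl}_{\beta X}A)\setminus X$, so $X^*=\beta X\setminus X$. $\mathcal{Z}(T)$ denotes the set of all zero-sets $f^{-1}(0)$ of continuous functions $f:T\to\mathbb{R}$. A sequence $\{U_n\}_{n<\omega}$ of non-empty open subsets of $X$ is an extension trace in $X$ if $\mathrm{cl}_XU_{n+1}\subseteq U_n$ for each $n$ and $\bigcap_nU_n=\emptyset$. It generates $Y=X\cup\{p\}\in\mathcal{E}(X)$ if $\{U_n\cup\{p\}\}_{n<\omega}$ is an open base at $p$ in $Y$; every extension trace generates an element of $\mathcal{E}(X)$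 and every element of $\mathcal{E}(X)$ is generated by an extension trace. For locally compact $X$, the map $\lambda:\mathcal{E}(X)\to\mathcal{Z}(X^* )$ is $\lambda(Y)=\bigcap_{n<\omega}U_n^*$, where $\{U_n\}$ is any extension trace generating $Y$ (this is well-defined and injective). For $X$ locally compact non-separable metrizable, $\sigma X$ is the set of those points of $\beta X$ that lie in the closure in $\beta X$ of some $\sigma$-compact subset of $X$ (an open subset of $\beta X$), and $c\sigma X=\beta X\setminus\sigma X$. Every such $X$ can be written as $\bigoplus_{i\in I}X_i$ with each $X_i$ non-compact separable. *)

(* Defs.v *)
From HB Require Import structures.
From mathcomp Require Import all_boot all_order all_algebra.
From mathcomp Require Import all_classical all_reals all_analysis.
From mathcomp Require Import lra.

Set Implicit Arguments.
Unset Strict Implicit.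
Unset Printing Implicit Defensive.

Import Order.TTheory GRing.Theory Num.Theory numFieldNormedType.Exports.

Local Open Scope classical_set_scope.
Local Open Scope ring_scope.

Definition metrizable (R : realType) (T : topologicalType) : Prop :=
  exists d : T -> T -> R,
    [/\ forall x y, (d x y = 0) <-> (x = y),
        forall x y, d x y = d y x,
        forall x y z, d x z <= d x y + d y z
      & forall (x : T) (A : set T),
          nbhs x A <-> exists2 r, 0 < r & [set y | d x y < r] `<=` A].

Definition separable (T : topologicalType) : Prop :=
  exists2 D : set T, countable D & dense D.

Definition discrete_space (T : topologicalType) : Prop :=
  forall A : set T, open A.

Definition sigma_compact (T : topologicalType) (A : set T) : Prop :=
  exists2 K : nat -> set T, forall n, compact (K n) & A = \bigcup_n K n.

Definition embedding (S T : topologicalType) (f : S -> T) : Prop :=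
  injective f /\
  forall A : set S, open A <-> exists2 B : set T, open B & A = f @^-1` B.

Definition homeomorphism (S T : topologicalType) (f : S -> T) : Prop :=
  embedding f /\ range f = [set: T].

(* the internal direct sum: the canonical map from the external sum of the
   subspaces Xi i, with the library topology on {i & _}, is a homeomorphism *)
Definition direct_sum (X : topologicalType) (I : choiceType)
    (Xi : I -> set X) : Prop :=
  homeomorphism (fun u : {i : I & set_type (Xi i)} => \val (projT2 u)).

(* f is relevant only on A: Z ranges over the zero-sets of the subspace A *)
Definition zero_sets (R : realType) (T : topologicalType) (A : set T) :
    set (set T) :=
  [set Z | exists2 f : T -> R,
     {within A, continuous f} & Z = A `&` f @^-1` [set 0]].

(* only meant for Z `<=` A: in subspace A the points outside A are isolated *)
Definition relative_interior (T : topologicalType) (A Z : set T) : set T :=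
  ((Z : set (subspace A))°).

(* (bX, e) is a Stone-Cech compactification of X; stone_cech_metrizable gives
   its existence for metrizable X. *)
Definition stone_cech (X bX : topologicalType) (e : X -> bX) : Prop :=
  [/\ compact [set: bX], hausdorff_space bX, embedding e, dense (range e)
    & forall (K : topologicalType) (f : X -> K),
        compact [set: K] -> hausdorff_space K -> continuous f ->
        exists2 g : bX -> K, continuous g & forall x, g (e x) = f x].

Lemma metrizable_open_ball (R : realType) (T : topologicalType)
    (d : T -> T -> R) :
  (forall x y z, d x z <= d x y + d y z) ->
  (forall (x : T) (A : set T),
     nbhs x A <-> exists2 r, 0 < r & [set y | d x y < r] `<=` A) ->
  forall x r, open [set y | d x y < r].
Proof.
move=> tri nb x r; rewrite openE => y /= xyr; apply/nb.
exists (r - d x y); first by rewrite subr_gt0.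
move=> z /= yz; apply: le_lt_trans (tri x y z) _; move: yz; lra.
Qed.

Lemma metrizable_hausdorff (R : realType) (T : topologicalType) :
  metrizable R T -> hausdorff_space T.
Proof.
move=> [d [d0 dC tri nb]] x y xy; apply/d0.
have dge0 u v : 0 <= d u v.
  have := tri u v u; rewrite (dC v u) (d0 u u).2 //; lra.
apply/eqP; rewrite eq_le dge0 andbT leNgt; apply/negP => dxy.
have r0 : 0 < d x y / 2 by rewrite divr_gt0.
have nB u : nbhs u [set v | d u v < d x y / 2] by apply/nb; exists (d x y / 2).
have [z [/= xz yz]] := xy _ _ (nB x) (nB y).
by have := tri x z y; rewrite (dC z y); move: xz yz; lra.
Qed.

Lemma metrizable_completely_regular (R : realType) (T : topologicalType) :
  metrizable R T -> @completely_regular_space T.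
Proof.
move=> [d [d0 dC tri nb]] a B clB nBa; apply/(@uniform_separatorP _ R).
have dge0 u v : 0 <= d u v.
  have := tri u v u; rewrite (dC v u) (d0 u u).2 //; lra.
have /nb[r r0 rB] : nbhs a (~` B).
  by apply: open_nbhs_nbhs; split=> //; exact: closed_openC.
have cda : continuous (d a).
  move=> x; apply/cvgrPdist_lt => e e0; apply/nb; exists e => // y /= xy.
  have := tri a x y; have := tri a y x; rewrite (dC y x) => ? ?.
  rewrite ltr_norml; lra.
exists (fun x => Num.min (d a x / r) 1); split.
- move=> x; apply: (@continuous_min _ _ (fun x => d a x / r) (fun=> 1)).
    by apply: continuousM; [exact: cda | exact: cst_continuous].
  exact: cst_continuous.
- move=> _ [x _ <-]; rewrite /= in_itv/= le_min ge_min lexx orbT ler01 !andbT.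
  by rewrite divr_ge0// ltW.
- by move=> _ [x -> <-] /=; rewrite (d0 a a).2// mul0r; apply/min_idPl.
- move=> _ [x Bx <-] /=; apply/min_idPr; rewrite ler_pdivlMr// mul1r leNgt.
  by apply/negP => /rB; apply.
Qed.

Section StoneCechExists.
Variable R : realType.

Definition unit_map (T : topologicalType) : set (T -> R) :=
  [set f : T -> R | continuous f /\ forall x, `[(0 : R), 1]%classic (f x)].

Definition unit_cube (T : topologicalType) : topologicalType :=
  prod_topology (fun _ : set_type (@unit_map T) => R : topologicalType).

Definition evaluation (T : topologicalType) (x : T) : unit_cube T :=
  fun f => \val f x.

Lemma proj_cont (T : topologicalType) (i : set_type (@unit_map T)) :
  continuous (fun y : unit_cube T => y i).
Proof. exact: (@proj_continuous _ (fun _ => R : topologicalType) i). Qed.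

Lemma unit_cube_continuous (S T : topologicalType) (f : S -> unit_cube T) :
  (forall i, continuous (fun x => f x i)) -> continuous f.
Proof.
move=> cf y; apply/cvg_sup => i U [_ [[V oV <-] /= Vy VU]].
have nV : nbhs (f y i) V by exact: open_nbhs_nbhs.
have H : nbhs y ((fun x => f x i) @^-1` V) by exact: cf nV.
by apply: (@filterS _ (nbhs y) _ _ (f @^-1` U) _ H) => z Vz; apply: VU.
Qed.

Lemma evaluation_embedding (T : topologicalType) :
  hausdorff_space T -> @completely_regular_space T ->
  embedding (@evaluation T).
Proof.
move=> hT crT.
pose F (i : set_type (@unit_map T)) : T -> R := \val i.
have cF i : continuous (F i) by case: i => f /= /[dup] /set_mem [].
have sep : separate_points_from_closed F.
  move=> U x clU nUx.
  have /(@uniform_separatorP _ R)[f [cf f01 fx fU]] := crT x U clU nUx.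
  have uf : unit_map f by split=> // y; apply: f01; exists y.
  exists (exist _ f (mem_set uf)); rewrite /F/=.
  have -> : f x = 0 by apply: fx; exists x.
  have cl1 : closed [set (1 : R)] by exact: closed_eq.
  move=> /(closureS fU); rewrite -(closure_id _).1//= => /eqP.
  by rewrite eq_sym oner_eq0.
have inj : set_inj [set: T] (join_product F).
  by apply: join_product_inj => //; exact: hausdorff_accessible.
split; first by move=> x y; apply: inj; rewrite inE.
move=> A; rewrite (join_product_initial sep cF inj); split.
  by case=> B oB <-; exists B.
by case=> B oB ->; exists B.
Qed.

Lemma embedding_continuous (S T : topologicalType) (f : S -> T) :
  embedding f -> continuous f.
Proof. by case=> _ fo; apply/continuousP => B oB; apply/fo; exists B. Qed.

Lemma unit_cube_hausdorff (T : topologicalType) : hausdorff_space (unit_cube T).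
Proof. by apply: hausdorff_product => i; exact: Rhausdorff. Qed.

Lemma set_type_hausdorff (T : topologicalType) (A : set T) :
  hausdorff_space T -> hausdorff_space (set_type A).
Proof.
move=> hT p q pq; apply: val_inj; apply: (hT) => U V nU nV.
have cv : continuous (set_val : set_type A -> T) by exact: initial_continuous.
have [z [? ?]] := pq _ _ (cv p U nU) (cv q V nV).
by exists (set_val z).
Qed.

Lemma set_type_compact (T : topologicalType) (A : set T) :
  compact A -> compact [set: set_type A].
Proof.
move=> cA F FF _.
pose G : set_system T := (set_val : set_type A -> T) @ F.
have GA : G A.
  by rewrite /G/= nbhs_simpl/=; apply: filterS filterT => x _; exact: set_valP.
have [x [Ax clx]] := cA G _ GA.
exists (exist _ x (mem_set Ax)); split=> // B C FB [_ [[V oV <-] /= Vx VC]].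
have GB : G (set_val @` B) by apply: (@filterS _ F _ B) FB => z Bz; exists z.
have [_ [[b Bb <-] Vb]] := clx _ V GB (open_nbhs_nbhs (conj oV Vx)).
by exists b; split=> //; exact: VC.
Qed.

Lemma stone_cech_exists (X : topologicalType) :
  hausdorff_space X -> @completely_regular_space X ->
  exists (bX : topologicalType) (e : X -> bX), stone_cech e.
Proof.
move=> hX crX.
have [einj eo] := evaluation_embedding hX crX.
set e := @evaluation X in einj eo.
pose A : set (unit_cube X) := closure (range e).
pose C : set (unit_cube X) := [set y | forall i, `[0, 1]%classic (y i)].
have cC : compact C.
  exact: (@tychonoff _ (fun _ => R : topologicalType) (fun _ => `[0,1]%classic)
    (fun _ => @segment_compact R 0 1)).
have clC : closed C by apply: compact_closed => //; exact: unit_cube_hausdorff.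
have cA : compact A.
  apply: subclosed_compact cC _; first exact: closed_closure.
  rewrite [X in _ `<=` X](closure_id C).1//; apply: closureS => _ [x _ <-] i.
  by have [_] := set_valP i; exact.
have Ae x : A (e x) by apply: subset_closure; exists x.
pose eb x : set_type A := exist _ (e x) (mem_set (Ae x)).
have vcont : continuous (set_val : set_type A -> unit_cube X).
  exact: initial_continuous.
exists (set_type A), eb; split.
- exact: set_type_compact.
- exact/set_type_hausdorff/unit_cube_hausdorff.
- split=> [x y /(congr1 val)/einj //|U]; rewrite eo; split.
    move=> [B oB ->]; exists (set_val @^-1` B) => //.
    by exists B.
  by move=> [_ [B oB <-] ->]; exists B.
- move=> O [z Oz] [B oB BO]; move: Oz; rewrite -BO /= => Bz.
  have Az : A (set_val z) by exact: set_valP.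
  have [_ [[x _ <-] Bx]] := Az _ (open_nbhs_nbhs (conj oB Bz)).
  by exists (eb x); split=> //; exists x.
- move=> K f cK hK cf.
  have crK : @completely_regular_space K.
    apply: (@normal_completely_regular R); first exact: compact_normal.
    exact: hausdorff_accessible.
  have eK := evaluation_embedding hK crK; have [kinj ko] := eK.
  set k := @evaluation K in kinj ko eK.
  have compf (h : set_type (@unit_map K)) : unit_map (\val h \o f).
    case: h => h /= /[dup] /set_mem [ch h01] _; split; last by move=> x; exact: h01.
    by move=> x; apply: continuous_comp; [exact: cf | exact: ch].
  pose Phi (y : unit_cube X) : unit_cube K :=
    fun h => y (SigSub (mem_set (compf h))).
  have cPhi : continuous Phi.
    by apply: unit_cube_continuous => h; exact: proj_cont.
  have clk : closed (range k).
    apply: compact_closed; first exact: unit_cube_hausdorff.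
    apply: continuous_compact => //.
    exact/continuous_subspaceT/embedding_continuous.
  have Phik (z : set_type A) : range k (Phi (set_val z)).
    have : A (set_val z) by exact: set_valP.
    rewrite (closure_id (range k)).1// => Az B nB.
    have [_ [[x _ <-] Bx]] := Az _ (cPhi _ _ nB).
    by exists (k (f x)); split; [exists (f x) | exact: Bx].
  pose g z := projT1 (cid2 (Phik z)).
  have gE z : k (g z) = Phi (set_val z) by rewrite /g; case: cid2.
  exists g; last by move=> x; apply: kinj; rewrite gE.
  apply/continuousP => U /ko[V oV ->].
  rewrite (_ : _ @^-1` _ = (Phi \o set_val) @^-1` V); last first.
    by apply/seteqP; split=> z /=; rewrite gE.
  apply: open_comp => // z _; apply: continuous_comp; [exact: vcont|exact: cPhi].
Qed.
Lemma stone_cech_metrizable (X : topologicalType) :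
  metrizable R X -> exists (bX : topologicalType) (e : X -> bX), stone_cech e.
Proof.
move=> mX; apply: stone_cech_exists; first exact: metrizable_hausdorff mX.
exact: metrizable_completely_regular mX.
Qed.

End StoneCechExists.

Definition extension_trace (X : topologicalType) (U : nat -> set X) : Prop :=
  [/\ forall n, open (U n), forall n, U n !=set0,
      forall n, closure (U n.+1) `<=` U n & \bigcap_n U n = set0].

(* The elements of E(X) are the classes of such extensions under homeomorphism
   over X; lambda below takes the same value on all members of a class. *)
Record one_point_extension (R : realType) (X : topologicalType) := {
  ext_space :> topologicalType;
  ext_incl : X -> ext_space;
  ext_point : ext_space;
  ext_metrizable : metrizable R ext_space;
  ext_embedding : embedding ext_incl;
  ext_range : range ext_incl = ~` [set ext_point];
  ext_dense : dense (range ext_incl)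
}.

Definition generates (R : realType) (X : topologicalType)
    (U : nat -> set X) (Y : one_point_extension R X) : Prop :=
  let B n := (@ext_incl R X Y @` U n) `|` [set ext_point Y] in
  (forall n, open (B n)) /\
  (forall V, nbhs (ext_point Y) V -> exists n, B n `<=` V).

Lemma every_extension_generated (R : realType) (X : topologicalType)
    (Y : one_point_extension R X) :
  exists U : nat -> set X, extension_trace U /\ generates U Y.
Proof.
case: Y => Y i p [d [d0 dC tri nb]] [iinj iopen] irange idense.
pose D n : set Y := [set y | d p y < n.+1%:R^-1].
have oD n : open (D n) by exact: metrizable_open_ball.
have dpp : d p p = 0 by apply/d0.
have dge0 x y : 0 <= d x y.
  have := tri x y x; rewrite (dC y x) (d0 x x).2 //; lra.
have Dp n : D n p by rewrite /D/= dpp invr_gt0.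
have pi x : i x <> p.
  by move=> ixp; have : range i (i x) by []; rewrite irange; apply.
have rangeE y : y <> p -> range i y by move=> yp; rewrite irange.
exists (fun n => i @^-1` (D n)); split; split.
- by move=> n; apply/iopen; exists (D n).
- move=> n; have [|y [Dy [x _ xy]]] := idense (D n) _ (oD n).
    by exists p.
  by exists x; rewrite /= xy.
- move=> n x clx; rewrite /D/=.
  have lt : n.+2%:R^-1 < n.+1%:R^-1 :> R by rewrite ltf_pV2 ?posrE// ltr_nat.
  rewrite ltNge; apply/negP => ge.
  pose r : R := n.+1%:R^-1 - n.+2%:R^-1.
  have r0 : 0 < r by rewrite subr_gt0.
  have /clx[z [/= Dz xz]] : nbhs x (i @^-1` [set y | d (i x) y < r]).
    apply: open_nbhs_nbhs; split; last by rewrite /= (d0 _ _).2.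
    by apply/iopen; eexists; last reflexivity; exact: metrizable_open_ball.
  have := tri p (i z) (i x); rewrite [d (i z) _]dC => tr.
  have := le_lt_trans tr (ltrD Dz xz).
  by rewrite /r addrC subrK ltNge ge.
- rewrite -subset0 => x capx; apply: (pi x); apply/esym/d0/eqP.
  rewrite eq_le dge0 andbT; apply/ler_addgt0Pl => e e0; rewrite addr0.
  have [n] := ltr_add_invr e0; rewrite add0r => ne.
  exact/ltW/(lt_trans _ ne)/(capx n).
- move=> n /=; suff -> : i @` (i @^-1` D n) `|` [set p] = D n by [].
  apply/seteqP; split => y.
    by move=> [[x Dx <-]//|->].
  move=> Dy; have [->|/rangeE [x _ xy]] := pselect (y = p); first by right.
  by left; exists x; rewrite //= xy.
- move=> /= V /nb [r r0 rV]; have [n] := ltr_add_invr r0; rewrite add0r => nr.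
  exists n => y [[x Dx <-]|->]; apply: rV; last by rewrite /= dpp.
  exact: lt_trans Dx nr.
Qed.

Section Growth.
Variables (X bX : topologicalType) (e : X -> bX).

Definition remainder : set bX := ~` range e.

Definition star (A : set X) : set bX := closure (e @` A) `\` range e.

(* [get] picks some extension trace generating Y: one exists by
   every_extension_generated, and lambdaE shows that the choice is irrelevant. *)
Definition lambda (R : realType) (Y : one_point_extension R X) : set bX :=
  \bigcap_n star (get [set U | extension_trace U /\ generates U Y] n).

Definition lambda_image (R : realType) : set (set bX) :=
  [set Z | exists Y : one_point_extension R X, lambda Y = Z].

Definition sigmaX : set bX :=
  [set q | exists2 A : set X, sigma_compact A & closure (e @` A) q].

Definition csigmaX : set bX := ~` sigmaX.

End Growth.

Lemma lambdaE (X bX : topologicalType) (e : X -> bX) (R : realType)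
    (Y : one_point_extension R X) (U : nat -> set X) :
  extension_trace U -> generates U Y ->
  lambda e Y = \bigcap_n star e (U n).
Proof.
move=> tU gU; rewrite /lambda.
set S := [set U | _].
have [tV gV] : S (get S).
  by apply: (@getPex _ S); exists U.
suff H (A B : nat -> set X) : generates A Y -> generates B Y ->
    \bigcap_n star e (A n) `<=` \bigcap_n star e (B n).
  by apply/seteqP; split; exact: H.
move=> [oA gA] [oB gB] q Aq n _.
have [m AB] : exists m, (ext_incl Y @` A m) `|` [set ext_point Y] `<=`
                        (ext_incl Y @` B n) `|` [set ext_point Y].
  by apply: gA; apply: open_nbhs_nbhs; split; [exact: oB | right].
have subAB : A m `<=` B n.
  move=> x Ax; have [|[z Bz /(ext_embedding Y).1 <-//]|ip] := AB (ext_incl Y x).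
  - by left; exists x.
  - have : range (ext_incl Y) (ext_incl Y x) by exists x.
    by rewrite ext_range ip => /(_ erefl).
have [clq nq] := Aq m I; split=> //.
by apply: closureS clq; exact: image_subset.
Qed.

(* Main.v *)
From HB Require Import structures.
Require Import Defs.
From mathcomp Require Import all_boot all_order all_algebra.
From mathcomp Require Import all_classical all_reals all_analysis.
From mathcomp Require Import lra.

Set Implicit Arguments.
Unset Strict Implicit.
Unset Printing Implicit Defensive.

Import Order.TTheory GRing.Theory Num.Theory numFieldNormedType.Exports.

Local Open Scope classical_set_scope.
Local Open Scope ring_scope.

(** Three facts carry the proof.

    First, the image of lambda consists of the non-empty zero-sets of bX that
    miss X.  If d is a metric of an extension Y with new point p, the function
    x |-> min (d p x) 1 on X is positive and extends to bX; its zero-set there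
    is lambda Y ([lambda_zero_set]).  Conversely a continuous g on bX that is
    positive on X metrizes X together with a point p whose distance to x is
    g x ([zero_set_lambda]).  So the question whether a zero-set Z of the
    remainder lies in the image of lambda is whether Z, cut out in the
    remainder by some g : bX -> R, can be cut out by a g without zeros in X.

    Second, write ix x for the index i of the summand Xi i that contains x.
    Each Xi i is sigma-compact and a compact set meets finitely many of
    them, so sigma bX is the union of the closures of the clopen sets
    ix @^-1` C with C countable.  Therefore a neighbourhood of a point of
    c sigma bX meets uncountably many summands
    ([csigmaX_uncountable_trace]), and conversely a set S that meets
    uncountably many summands has a point of c sigma bX in its closure; if
    G > 0 on S, that point can be chosen with G > 0, because some set
    {x in S | G x >= 1/n} still meets uncountably many summands
    ([uncountable_escapes_sigmaX]).  This proves that the trace of lambda Y on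
    c sigma bX has empty interior: if an open V meets c sigma bX, the function
    g of Y is positive at some point of V in each of uncountably many summands,
    hence positive at a point of c sigma bX adherent to V ([interior_csigmaX]).

    Third, zeros in X that lie in countably many summands are harmless: these
    summands form a sigma-compact set, and some G >= 0 is positive there and
    zero on the remainder ([sigma_compact_zero_set]), so that g may be replaced
    by g + G.  If all but countably many summands are discrete, the zeros of g
    in the discrete ones form a clopen set A.  If A met uncountably many
    summands, its closure would be a clopen part of bX on which g = 0 and which
    meets c sigma bX, against the interior condition.  If uncountably many
    summands are not discrete, let g vanish in X exactly at one non-isolated
    point of each of them.  An open set meeting a summand then contains a point
    of it where g > 0, so the interior condition holds as above; but every
    function that vanishes on the same part of the remainder as g has a zero
    in X, because the zeros of g in X accumulate at points of c sigma bX. *)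

(** * Continuous functions on X and on its Stone-Cech compactification *)

Lemma locally_constant_continuous (S T : topologicalType) (f : S -> T) :
  (forall x, nbhs x [set y | f y = f x]) -> continuous f.
Proof.
move=> fc x A /nbhs_singleton Afx.
by apply: (filterS _ (fc x)) => y /= ->.
Qed.

Lemma indicator_continuous (R : realType) (X : topologicalType) (A : set X) :
  open A -> open (~` A) -> continuous (fun x => (x \in A)%:R : R).
Proof.
move=> oA oA'; apply: locally_constant_continuous => x.
have [Ax|nAx] := pselect (A x).
  apply: (filterS _ (open_nbhs_nbhs (conj oA Ax))) => y Ay /=.
  by rewrite !mem_set.
apply: (filterS _ (open_nbhs_nbhs (conj oA' nAx))) => y Ay /=.
by rewrite !memNset.
Qed.

Section Zero_set_bigcap.
Variables (R : realType) (T : topologicalType) (h : nat -> T -> R).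
Hypothesis h_cont : forall n, continuous (h n).
Hypothesis h01 : forall n x, 0 <= h n x <= 1.

Let G x := sup (range (fun n => h n x / n.+1%:R)).

Let term_le1 n x : 0 <= h n x / n.+1%:R <= n.+1%:R^-1.
Proof.
have /andP[h0 h1] := h01 n x.
by rewrite divr_ge0//= ler_piMl// invr_ge0.
Qed.

Let invn_le1 n : n.+1%:R^-1 <= 1 :> R.
Proof. by rewrite invf_le1// ler1n. Qed.

Let ub1 x : ubound (range (fun n => h n x / n.+1%:R)) 1.
Proof.
move=> _ [n _ <-]; have /andP[_] := term_le1 n x.
by move=> /le_trans; apply; exact: invn_le1.
Qed.

Let term_le n x : h n x / n.+1%:R <= G x.
Proof. by apply: ub_le_sup; [exists 1; exact: ub1 | exists n]. Qed.

Let ne x : range (fun n => h n x / n.+1%:R) !=set0.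
Proof. by exists (h 0%N x / 1%:R); exists 0%N. Qed.

(** The supremum of the h n / (n+1) is continuous because near a given point it
    is, up to an arbitrary error, a maximum of finitely many of them: the terms
    beyond 1/eps are smaller than eps. *)
Lemma countable_zero_set_bigcap :
  exists g : T -> R, [/\ continuous g, forall x, 0 <= g x <= 1
    & forall x, g x = 0 <-> forall n, h n x = 0].
Proof.
exists G; split.
- move=> x; apply/cvgrPdist_le => eps eps0.
  have [N] := ltr_add_invr eps0; rewrite add0r => Neps.
  have nearN M : \forall y \near x, forall n, (n < M)%N ->
      `|h n x / n.+1%:R - h n y / n.+1%:R| <= eps.
    elim: M => [|M IH]; first by apply: nearW.
    have cM : (fun y => h M y / M.+1%:R) @ x --> h M x / M.+1%:R.
      by apply: cvgM; [exact: h_cont | exact: cvg_cst].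
    have /cvgrPdist_le/(_ eps eps0) := cM.
    apply: filter_app; apply: filterS IH => y IH yM n.
    by rewrite ltnS leq_eqVlt => /predU1P[->//|]; exact: IH.
  apply: filterS (nearN N) => y H.
  have {}H n : `|h n x / n.+1%:R - h n y / n.+1%:R| <= eps.
    have [/H//|Nn] := ltnP n N.
    apply: le_trans (ltW Neps); have : n.+1%:R^-1 <= N.+1%:R^-1 :> R.
      by rewrite lef_pV2 ?posrE// ler_nat.
    apply: le_trans; have := term_le1 n x; have := term_le1 n y.
    move: n.+1%:R^-1 (h n x / _) (h n y / _) => c a b /andP[? ?] /andP[? ?].
    by rewrite ler_norml; apply/andP; split; lra.
  have HGx : G x <= G y + eps.
    apply: ge_sup; first exact: ne.
    move=> _ [n _ <-]; have := term_le n y; have := H n.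
    move: (h n x / _) (h n y / _) => a b; rewrite ler_norml => /andP[? ?] ?.
    by lra.
  have HGy : G y <= G x + eps.
    apply: ge_sup; first exact: ne.
    move=> _ [n _ <-]; have := term_le n x; have := H n.
    move: (h n x / _) (h n y / _) => a b; rewrite ler_norml => /andP[? ?] ?.
    by lra.
  by rewrite ler_norml; apply/andP; split; lra.
- move=> x; rewrite (ge_sup (ne x) (@ub1 x)) andbT.
  by apply: le_trans (term_le 0%N x); case/andP: (term_le1 0%N x).
- move=> x; split=> [G0 n|h0].
    have := term_le n x; rewrite G0 => le0.
    have /andP[ge0 _] := term_le1 n x.
    have /eqP : h n x / n.+1%:R = 0 by apply/eqP; rewrite eq_le le0 ge0.
    by rewrite mulf_eq0 invr_eq0 pnatr_eq0 orbF => /eqP.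
  apply/eqP; rewrite eq_le; apply/andP; split.
    by apply: ge_sup; [exact: ne|move=> _ [n _ <-]; rewrite h0 mul0r].
  by apply: le_trans (term_le 0%N x); rewrite h0 mul0r.
Qed.

End Zero_set_bigcap.

Section Stone_Cech_facts.
Variables (R : realType) (X bX : topologicalType) (e : X -> bX).
Hypothesis sce : stone_cech e.

Let compb : compact [set: bX]. Proof. by have [H _ _ _ _] := sce. Qed.
Let hausb : hausdorff_space bX. Proof. by have [_ H _ _ _] := sce. Qed.
Let emb : embedding e. Proof. by have [_ _ H _ _] := sce. Qed.
Let dns : dense (range e). Proof. by have [_ _ _ H _] := sce. Qed.

Lemma stone_cech_continuous : continuous e.
Proof. exact: embedding_continuous emb. Qed.

Lemma stone_cech_extend (f : X -> R) :
  continuous f -> (forall x, 0 <= f x <= 1) ->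
  exists g : bX -> R, [/\ continuous g, forall y, 0 <= g y <= 1
    & forall x, g (e x) = f x].
Proof.
move=> cf f01; pose K := `[0, 1]%classic : set R.
have fK x : K (f x) by rewrite /K/= in_itv/= f01.
pose fK' x : set_type K := exist _ (f x) (mem_set (fK x)).
have [_ _ _ _] := sce.
move=> /(_ (set_type K : topologicalType) fK')[].
- exact/set_type_compact/segment_compact.
- exact/set_type_hausdorff/Rhausdorff.
- apply/continuousP => _ [U oU <-].
  by move/continuousP: cf => /(_ U oU).
move=> g cg gE; exists (fun y => set_val (g y)); split.
- move=> y; apply: continuous_comp; first exact: cg.
  exact: initial_continuous.
- by move=> y; have := set_valP (g y); rewrite /K/= in_itv.
- by move=> x; rewrite gE.
Qed.

Lemma closure_trace (V : set bX) (q : bX) :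
  open V -> V q -> closure (e @` (e @^-1` V)) q.
Proof.
move=> oV Vq B; rewrite nbhsE => -[W [oW Wq] WB].
have [|y [[Vy Wy] [x _ xy]]] := dns _ (openI oV oW); first by exists q.
by exists y; split; [exists x => //=; rewrite xy|exact: WB].
Qed.

Lemma closure_le (g : bX -> R) (S : set X) (a : R) (q : bX) :
  continuous g -> (forall x, S x -> g (e x) <= a) ->
  closure (e @` S) q -> g q <= a.
Proof.
move=> cg Sa clq.
have cl : closed (g @^-1` [set r | r <= a]).
  by apply: closed_comp => [x _|]; [exact: cg|exact: closed_le].
suff : closure (g @^-1` [set r | r <= a]) q by rewrite -(closure_id _).1.
by apply: closureS clq => _ [x Sx <-]; exact: Sa.
Qed.

Lemma closure_ge (g : bX -> R) (S : set X) (a : R) (q : bX) :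
  continuous g -> (forall x, S x -> a <= g (e x)) ->
  closure (e @` S) q -> a <= g q.
Proof.
move=> cg Sa clq.
have cNg : continuous (fun y => - g y).
  by move=> y; apply: continuousN; exact: cg.
rewrite -lerN2; apply: (closure_le cNg _ clq) => x Sx.
by rewrite lerN2; exact: Sa.
Qed.

(** The indicator of a clopen set extends to bX and separates the closures. *)
Lemma closure_clopen_disjoint (A : set X) (q : bX) :
  open A -> open (~` A) ->
  closure (e @` A) q -> ~ closure (e @` (~` A)) q.
Proof.
move=> oA oA' clA clA'.
have [|g [cg _ gE]] := stone_cech_extend (@indicator_continuous R _ _ oA oA').
  by move=> x; case: (_ \in _); rewrite ?lexx ler01.
have g1 : 1 <= g q.
  by apply: (closure_ge cg _ clA) => x Ax; rewrite gE mem_set.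
have g0 : g q <= 0.
  by apply: (closure_le cg _ clA') => x Ax; rewrite gE memNset.
by move: (le_trans g1 g0); rewrite ler10.
Qed.

Lemma range_sub_sigmaX (x : X) : sigmaX e (e x).
Proof.
exists [set x].
  exists (fun=> [set x]); first by move=> _; exact: compact_set1.
  by apply/seteqP; split=> [y ->|y [] //]; exists 0%N.
by apply: subset_closure; exists x.
Qed.


(** An open B of bX whose trace on X lies in a compact K is contained in K:
    outside of K it would be open without a point of the dense set X. *)
Lemma locally_compact_open_range : locally_compact [set: X] -> open (range e).
Proof.
move=> lcX; rewrite openE => _ [x _ <-].
have [K nK [cK _]] := lcX x I.
have {nK} : nbhs x K.
  by move: nK; rewrite /within/=; apply: filterS => y; exact.
rewrite nbhsE => -[W [oW Wx] WK].
have [B oB WB] := (emb.2 W).1 oW.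
have cleK : closed (e @` K).
  apply: compact_closed => //; apply: continuous_compact => //.
  exact/continuous_subspaceT/stone_cech_continuous.
have BK : B `<=` e @` K.
  move=> y By; apply: contrapT => nKy.
  have [|z [[Bz nKz] [t _ tz]]] := dns _ (openI oB (closed_openC cleK)).
    by exists y.
  by apply: nKz; exists t => //; apply: WK; rewrite WB /= tz.
apply: (filterS _ (open_nbhs_nbhs (conj oB _))).
  by move=> y /BK[z _ <-]; exists z.
by move: Wx; rewrite WB.
Qed.

(** As X is open in bX, the remainder is closed and Tietze's theorem applies to
    min(|f|, 1), a bounded function with the same zeros as f. *)
Lemma tietze_remainder (f : bX -> R) :
  open (range e) -> {within remainder e, continuous f} ->
  exists F : bX -> R, [/\ continuous F, forall y, 0 <= F y
    & forall y, remainder e y -> (F y = 0 <-> f y = 0)].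
Proof.
move=> oe cf; pose m y : R := Num.min `|f y| 1.
have m01 y : 0 <= m y <= 1.
  by rewrite /m le_min normr_ge0 ler01 ge_min lexx orbT.
have clr : closed (remainder e) by exact: open_closedC.
have cm : {within remainder e, continuous m}.
  move=> y; apply: (@continuous_min R (subspace (remainder e))
     (fun y => `|f y|) (fun=> 1)); last exact: cst_continuous.
  apply: (@continuous_comp (subspace (remainder e)) R R f (fun r => `|r|)).
    exact: cf.
  exact: norm_continuous.
have [|F [mF cF _]] := @continuous_bounded_extension bX R
    (compact_normal hausb compb) _ clr m 1 ltr01 cm.
  by move=> y _; have /andP[m0 m1] := m01 y; rewrite ger0_norm.
exists (fun y => `|F y|); split => //.
  move=> y; apply: (@continuous_comp _ _ _ F (fun r : R => `|r|)).
    exact: cF.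
  exact: norm_continuous.
move=> y ry; rewrite -mF ?inE// /m; split => [/eqP|->].
  rewrite normr_eq0 => /eqP; rewrite /Num.min; case: ifP => [_ /eqP|_ /eqP].
    by rewrite normr_eq0 => /eqP.
  by rewrite oner_eq0.
by rewrite normr0 (min_idPl _) ?ler01// normr0.
Qed.

(** Urysohn functions that are 0 on the remainder and 1 on the compact pieces of
    A; the zero-set of G is the intersection of theirs. *)
Lemma sigma_compact_zero_set (A : set X) :
  open (range e) -> sigma_compact A ->
  exists G : bX -> R, [/\ continuous G, forall y, 0 <= G y,
    forall y, remainder e y -> G y = 0 & forall x, A x -> 0 < G (e x)].
Proof.
move=> oe [K cK ->].
have clr : closed (remainder e) by exact: open_closedC.
have H n : exists h : bX -> R, [/\ continuous h, forall y, 0 <= h y <= 1,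
    forall y, remainder e y -> h y = 0 & forall x, K n x -> h (e x) = 1].
  have clK : closed (e @` K n).
    apply: compact_closed => //; apply: continuous_compact => //.
    exact/continuous_subspaceT/stone_cech_continuous.
  have [|h [ch h01 h0 h1]] := (@uniform_separatorP _ R _ _).1
      (normal_uniform_separator (compact_normal hausb compb) clr clK _).
    by apply/seteqP; split=> // y [ny [x _ xy]]; apply: ny; exists x.
  exists h; split => //.
  - by move=> y; have := h01 (h y); rewrite /= in_itv/=; apply; exists y.
  - by move=> y ry; apply: h0; exists y.
  - by move=> x Kx; apply: h1; exists (e x) => //; exists x.
have {H} [h H] := choice H.
have [|y|G [cG G01 G0]] := @countable_zero_set_bigcap R bX h.
- by move=> n; have [] := H n.
- by have [_ h01 _ _] := H y.
exists G; split => //.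
- by move=> y; have /andP[] := G01 y.
- by move=> y ry; apply/G0 => n; have [_ _ h0 _] := H n; exact: h0.
- move=> x [n _ Kx]; have /andP[Gx _] := G01 (e x).
  rewrite lt_neqAle Gx andbT eq_sym; apply/eqP => /G0/(_ n).
  have [_ _ _ h1] := H n; rewrite h1// => /eqP; rewrite oner_eq0//.
Qed.

End Stone_Cech_facts.

(** * Sets that meet uncountably many summands *)

(** The images of the S `\` ix @^-1` C with C countable generate a proper
    filter; q is one of its cluster points. *)
Lemma uncountable_cluster (X I : Type) (T : topologicalType) (ix : X -> I)
    (f : X -> T) (S : set X) (A : set T) :
  compact A -> f @` S `<=` A -> ~ countable (ix @` S) ->
  exists2 q, A q &
    forall C, countable C -> closure (f @` (S `\` ix @^-1` C)) q.
Proof.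
move=> cA fSA nc.
pose F : set_system T :=
  [set B | exists2 C, countable C & f @` (S `\` ix @^-1` C) `<=` B].
have FF : ProperFilter F.
  apply: Build_ProperFilter_ex.
    move=> B [C cC CB].
    have [x [Sx nCx]] : S `\` ix @^-1` C !=set0.
      apply: contrapT => /nonemptyPn/seteqP[SC _]; apply: nc.
      apply: sub_countable cC; apply: subset_card_le => _ [x Sx <-].
      by apply: contrapT => nCx; apply: (SC x).
    by exists (f x); apply: CB; exists x.
  split.
  - by exists set0 => //; exact: countable0.
  - move=> B B' [C cC CB] [C' cC' CB']; exists (C `|` C').
      rewrite -bigcup2E; apply: bigcup_countable => // n _.
      by case: n => [|[|n]] /=.
    move=> _ [x [Sx nx] <-]; split.
      by apply: CB; exists x => //; split=> // Cx; apply: nx; left.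
    by apply: CB'; exists x => //; split=> // Cx; apply: nx; right.
  - by move=> B B' BB' [C cC CB]; exists C => //; exact: subset_trans BB'.
have [|q [Aq clq]] := cA F FF.
  by exists set0 => // y [x [Sx _] <-]; apply: fSA; exists x.
exists q => // C cC B nB; apply: clq => //.
by exists C.
Qed.

Lemma bigcup_sigma_compact (X : topologicalType) (I : Type) (C : set I)
    (A : I -> set X) :
  countable C -> (forall i, sigma_compact (A i)) ->
  sigma_compact (\bigcup_(i in C) A i).
Proof.
move=> /countable_injP[c cinj] scA.
have /choice[A_ AP] : forall i, exists A_ : nat -> set X,
    (forall n, compact (A_ n)) /\ A i = \bigcup_n A_ n.
  by move=> i; have [A_ cA AE] := scA i; exists A_.
(* D m has at most one element: the i in C numbered m. *)
pose D (m : nat) := C `&` c @^-1` [set m].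
exists (fun n => if unpickle n is Some (m, k) then \bigcup_(i in D m) A_ i k
                 else set0).
  move=> n; case: unpickle => [[m k]|]; last exact: compact0.
  have [[i [Ci ci]]|nD] := pselect (D m !=set0); last first.
    suff -> : D m = set0 by rewrite bigcup_set0; exact: compact0.
    exact/nonemptyPn.
  suff -> : D m = [set i] by rewrite bigcup_set1; exact: (AP i).1.
  apply/seteqP; split=> [j [Cj cj]|j -> //].
  by apply: cinj; rewrite ?inE// cj ci.
apply/seteqP; split=> [x [i Ci]|x [n _]].
  rewrite (AP i).2 => -[k _ Ak]; exists (pickle (c i, k)) => //.
  by rewrite pickleK; exists i.
case: unpickle => [[m k] [i [Ci _] Aik]|//].
by exists i => //; rewrite (AP i).2; exists k.
Qed.

Section Direct_sum.
Variables (R : realType) (X bX : topologicalType) (e : X -> bX).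
Hypothesis sce : stone_cech e.
Variables (I : Type) (ix : X -> I).
Hypothesis ix_open : forall C : set I, open (ix @^-1` C).
Hypothesis ix_sigma : forall i, sigma_compact (ix @^-1` [set i]).

(** A cluster point x as in [uncountable_cluster], with f the identity, cannot
    exist: its neighbourhood ix @^-1` [set ix x] is one of the sets removed. *)
Lemma compact_index_countable (A : set X) :
  compact A -> countable (ix @` A).
Proof.
move=> cA; apply: contrapT => nc.
have [|x Ax /(_ [set ix x] (countable1 _))] :=
  uncountable_cluster (f := id) cA _ nc; first by rewrite image_id.
move=> /(_ (ix @^-1` [set ix x])) [|y [[z [_ nz] <-]]]; last exact: nz.
by apply: open_nbhs_nbhs; split; [exact: ix_open|].
Qed.

Lemma sigma_compact_index_countable (A : set X) :
  sigma_compact A -> countable (ix @` A).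
Proof.
move=> [A_ cA ->]; rewrite image_bigcup; apply: bigcup_countable => // n _.
exact: compact_index_countable.
Qed.

Lemma countable_index_sigma_compact (C : set I) :
  countable C -> sigma_compact (ix @^-1` C).
Proof.
move=> cC; have -> : ix @^-1` C = \bigcup_(i in C) ix @^-1` [set i].
  by apply/seteqP; split=> [x Cx|x [i Ci /= ->//]]; exists (ix x).
exact: bigcup_sigma_compact.
Qed.

(** Otherwise the trace of V lies in countably many summands, whose union is
    sigma-compact, and V is contained in the closure of its trace. *)
Lemma csigmaX_uncountable_trace (V : set bX) (q : bX) :
  open V -> V q -> csigmaX e q -> ~ countable (ix @` (e @^-1` V)).
Proof.
move=> oV Vq nsq cV; apply: nsq.
exists (ix @^-1` (ix @` (e @^-1` V))).
  exact: countable_index_sigma_compact.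
apply: closureS (closure_trace sce oV Vq).
by apply: image_subset => x Vx; exists x.
Qed.

(** Only the part of S where G >= 1/(n+1) is used, with n such that this part
    still meets uncountably many summands: this bounds G away from 0 at the
    cluster point.  The cluster point is not adherent to a sigma-compact set,
    which lies in a clopen set ix @^-1` C, C countable, while q is adherent to
    its complement. *)
Lemma uncountable_escapes_sigmaX (S : set X) (G : bX -> R) :
  continuous G -> (forall x, S x -> 0 < G (e x)) -> ~ countable (ix @` S) ->
  exists q, [/\ closure (e @` S) q, csigmaX e q & 0 < G q].
Proof.
move=> cG SG nc.
have [n ncn] : exists n,
    ~ countable (ix @` (S `&` [set x | n.+1%:R^-1 <= G (e x)])).
  apply: contrapT => /forallNP H; apply: nc.
  have -> : S = \bigcup_n (S `&` [set x | n.+1%:R^-1 <= G (e x)]).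
    apply/seteqP; split=> [x Sx|x [n _ []]//].
    have [n] := ltr_add_invr (SG _ Sx); rewrite add0r => nG.
    by exists n => //; split=> //; exact: ltW.
  rewrite image_bigcup; apply: bigcup_countable => // n _.
  exact: contrapT (H n).
have compb : compact [set: bX] by have [H _ _ _ _] := sce.
have [//|q _ clq] := uncountable_cluster (f := e) compb _ ncn.
have clq0 := clq set0 (countable0 I).
rewrite preimage_set0 setD0 in clq0.
exists q; split.
- by apply: closureS clq0; apply: image_subset => x [].
- move=> [A scA clA].
  have cC := sigma_compact_index_countable scA.
  have oC : open (ix @^-1` (ix @` A)) by exact: ix_open.
  have oC' : open (~` (ix @^-1` (ix @` A))).
    by rewrite preimage_setC; exact: ix_open.
  apply: (closure_clopen_disjoint R sce oC oC').
    by apply: closureS clA; apply: image_subset => x Ax; exists x.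
  by apply: closureS (clq _ cC); apply: image_subset => x [].
- have : n.+1%:R^-1 <= G q by apply: (closure_ge cG _ clq0) => x [].
  by apply: lt_le_trans; rewrite invr_gt0.
Qed.

(** This is how the interior condition is refuted: V has its closure inside W,
    so if the points of V with F > 0 met uncountably many summands, they would
    have an adherent point with F > 0 in W and outside of sigma bX. *)
Lemma interior_csigmaX (W : set bX) (F : bX -> R) (q : bX) :
  continuous F -> nbhs q W -> csigmaX e q ->
  (forall y, W y -> csigmaX e y -> F y <= 0) ->
  exists2 V : set bX, open V /\ V q &
    countable (ix @` [set x | V (e x) /\ 0 < F (e x)]).
Proof.
move=> cF nW sq WF.
have [compb hausb _ _ _] := sce.
have [V nV VW] := compact_regular hausb compb (filterT : nbhs q setT) nW.
have [V' [oV' V'q] V'V] : exists2 V' : set bX, open V' /\ V' q & V' `<=` V.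
  by move: nV; rewrite nbhsE => -[V' [? ?] ?]; exists V'.
exists V' => //; apply: contrapT => nc.
have [x [_ Fx]//|y [cly sy Fy]] := uncountable_escapes_sigmaX cF _ nc.
have Wy : W y.
  apply: VW; apply: closureS cly => _ [x [Vx _] <-]; exact: V'V.
by have := WF y Wy sy; rewrite leNgt Fy.
Qed.

End Direct_sum.

(** * The image of lambda *)

Section Lambda_zero_set.
Variables (R : realType) (X bX : topologicalType) (e : X -> bX).
Hypothesis sce : stone_cech e.

(** Every trace that generates Y is cofinal with the sets {g < r}, r > 0, since
    both give neighbourhood bases of the new point. *)
Lemma lambda_zero_setE (Y : one_point_extension R X) (g : bX -> R) :
  continuous g -> (forall x, 0 < g (e x)) ->
  (forall V : set Y, nbhs (ext_point Y) V <->
    V (ext_point Y) /\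
    exists2 r, 0 < r & forall x, g (e x) < r -> V (ext_incl Y x)) ->
  lambda e Y = g @^-1` [set 0].
Proof.
move=> cg g0 nbp.
have [U [tU gU]] := every_extension_generated Y.
rewrite (lambdaE e tU gU); case: gU => oB gB.
have inc_pt x : ext_incl Y x <> ext_point Y.
  move=> xp; have : range (ext_incl Y) (ext_incl Y x) by exists x.
  by rewrite ext_range xp; apply.
have incl_inj := (ext_embedding Y).1.
have gge0 y : 0 <= g y.
  apply: (closure_ge cg (S := e @^-1` setT) (a := 0)); last first.
    exact: (closure_trace sce openT).
  by move=> x _; exact: ltW.
apply/seteqP; split => y.
  move=> sy /=; apply/eqP; rewrite eq_le gge0 andbT.
  apply/ler_addgt0Pl => r r0; rewrite addr0.
  pose V : set Y := [set ext_point Y] `|` ext_incl Y @` [set x | g (e x) < r].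
  have /gB[n nV] : nbhs (ext_point Y) V.
    by apply/nbp; split; [left|exists r => // x gx; right; exists x].
  have [cly _] := sy n I.
  apply: (closure_le cg _ cly) => x Ux.
  have [/inc_pt//|[z gz /incl_inj xz]] : V (ext_incl Y x).
    by apply: nV; left; exists x.
  by rewrite -xz ltW.
move=> /= gy n _; split; last first.
  by move=> [x _ xy]; have := g0 x; rewrite xy gy ltxx.
have /nbp[_ [r r0 rB]] : nbhs (ext_point Y)
    ((ext_incl Y @` U n) `|` [set ext_point Y]).
  by apply: open_nbhs_nbhs; split; [exact: oB|right].
have or : open (g @^-1` [set s | s < r]).
  by apply: open_comp => [? _|]; [exact: cg|exact: open_lt].
apply: closureS (closure_trace sce or _); last by rewrite /= gy.
apply: image_subset => x /rB[[z Uz /incl_inj <-]//|/inc_pt//].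
Qed.

(** g extends the distance to the new point, truncated at 1. *)
Lemma lambda_zero_set (Y : one_point_extension R X) :
  exists g : bX -> R, [/\ continuous g, forall x, 0 < g (e x)
    & lambda e Y = g @^-1` [set 0]].
Proof.
have [d [d0 dC tri nb]] := ext_metrizable Y.
have dge0 x y : 0 <= d x y.
  have := tri x y x; rewrite (dC y x) (d0 x x).2 //; lra.
set p := ext_point Y in d0 dC tri nb *; pose i := ext_incl Y.
have ip x : i x <> p.
  move=> xp; have : range i (i x) by exists x.
  by rewrite /i ext_range -/i xp; apply.
have ci : continuous i by exact: embedding_continuous (ext_embedding Y).
pose F x : R := Num.min (d p (i x)) 1.
have F0 x : 0 < F x.
  rewrite lt_min ltr01 andbT lt_neqAle dge0 andbT eq_sym.
  by apply/eqP => /d0/esym/ip.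
have cdp : continuous (d p).
  move=> x; apply/cvgrPdist_lt => r r0; apply/nb; exists r => // y /= xy.
  have := tri p x y; have := tri p y x; rewrite (dC y x) => ? ?.
  by rewrite ltr_norml; apply/andP; split; lra.
have cF : continuous F.
  move=> x; apply: (@continuous_min _ _ (fun x => d p (i x)) (fun=> 1)).
    by apply: continuous_comp; [exact: ci|exact: cdp].
  exact: cst_continuous.
have [|g [cg _ gE]] := stone_cech_extend sce cF.
  by move=> x; rewrite ltW//= /F ge_min lexx orbT.
exists g; split => //; first by move=> x; rewrite gE.
apply: lambda_zero_setE => // [x|V]; first by rewrite gE.
have dpp : d p p = 0 by apply/d0.
split=> [nV|[Vp [r r0 rV]]].
  split; first exact: nbhs_singleton nV.
  move/nb: nV => [r r0 rV]; exists (Num.min r 1).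
    by rewrite lt_min r0 ltr01.
  move=> x; rewrite gE => Fx; apply: rV => /=.
  move: Fx; rewrite lt_min /F /Num.min -/i.
  by case: ifP => _ /andP[// _]; rewrite ltxx.
apply/nb; exists (Num.min r 1) => [|y /=]; first by rewrite lt_min r0 ltr01.
rewrite lt_min => /andP[yr y1].
have [->//|yp] := pselect (y = p).
have [x _ xy] : range i y by rewrite /i ext_range.
by rewrite -xy; apply: rV; rewrite gE /F -/i xy gt_min yr.
Qed.

End Lambda_zero_set.

Section Metric_extension.
Variables (R : realType) (X : topologicalType) (d : X -> X -> R) (F : X -> R).
Hypothesis d0 : forall x y, (d x y = 0) <-> (x = y).
Hypothesis dC : forall x y, d x y = d y x.
Hypothesis tri : forall x y z, d x z <= d x y + d y z.
Hypothesis nb : forall (x : X) (A : set X),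
  nbhs x A <-> exists2 r, 0 < r & [set y | d x y < r] `<=` A.
Hypothesis F_gt0 : forall x, 0 < F x.
Hypothesis F_cont : continuous F.

(** [None] is the new point.  Adding |F x - F y| to d makes F 1-Lipschitz
    without changing the topology of X; a path between two points of X either
    stays in X or goes through the new point, which costs F x + F y. *)
Definition extension_dist (u v : option X) : R :=
  match u, v with
  | Some x, Some y => Num.min (d x y + `|F x - F y|) (F x + F y)
  | Some x, None | None, Some x => F x
  | None, None => 0
  end.

Let d_ge0 x y : 0 <= d x y.
Proof. have := tri x y x; rewrite (dC y x) (d0 x x).2 //; lra. Qed.

Lemma extension_distxx u : extension_dist u u = 0.
Proof.
case: u => //= x; rewrite (d0 x x).2// subrr normr0 addr0.
by apply/min_idPl; have := F_gt0 x; lra.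
Qed.

Lemma extension_dist_eq0 u v : extension_dist u v = 0 -> u = v.
Proof.
case: u v => [x|] [y|] //=; last 2 first.
- by move=> Fx; have := F_gt0 x; rewrite Fx ltxx.
- by move=> Fx; have := F_gt0 y; rewrite Fx ltxx.
have := F_gt0 x; have := F_gt0 y => Fx Fy.
have := normr_ge0 (F x - F y); have := d_ge0 x y => dxy nF.
rewrite /Num.min; case: ifP => _ H; last by exfalso; lra.
by congr Some; apply/d0; lra.
Qed.

Lemma extension_distC u v : extension_dist u v = extension_dist v u.
Proof. by case: u v => [x|] [y|] //=; rewrite dC distrC (addrC (F x)). Qed.

Lemma extension_dist_triangle v u w :
  extension_dist u w <= extension_dist u v + extension_dist v w.
Proof.
have Dtri x y z :
    d x z + `|F x - F z| <= d x y + `|F x - F y| + (d y z + `|F y - F z|).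
  have := tri x y z; have := ler_distD (F y) (F x) (F z); lra.
have FD x y : F x <= d x y + `|F x - F y| + F y.
  by have := d_ge0 x y; have := ler_norm (F x - F y); lra.
case: u v w => [x|] [y|] [z|] //=.
- have := Dtri x y z; have := FD x y; have := FD z y.
  rewrite (dC z y) (distrC (F z)).
  have := F_gt0 x; have := F_gt0 y; have := F_gt0 z.
  move: (d x z + _) (d x y + _) (d y z + _) => a b c ? ? ? ? ? ?.
  by rewrite /Num.min; do 3 (case: ltP => ?); lra.
- have := FD x y; have := F_gt0 y.
  move: (d x y + _) => b ? ?.
  by rewrite /Num.min; case: ltP => ?; lra.
- by rewrite ge_min; apply/orP; right.
- by have := F_gt0 x; lra.
- have := FD z y; have := F_gt0 y; rewrite dC distrC.
  move: (d _ _ + _) => b ? ?.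
  by rewrite /Num.min; case: ltP => ?; lra.
- by have := F_gt0 y; lra.
- by lra.
Qed.

Definition metric_extension : metricType R :=
  HB.pack (option X) (isMetric.Build R (option X) extension_distxx
    extension_dist_eq0 extension_distC extension_dist_triangle).

Lemma nbhs_metric_extension_None (V : set metric_extension) :
  nbhs (None : metric_extension) V <->
  V None /\ exists2 r, 0 < r & forall x, F x < r -> V (Some x).
Proof.
rewrite nbhs_ballP; split=> [[r r0]|[VN [r r0 rV]]].
  rewrite ballEmdist => rV; split; first by apply: rV; rewrite /= mdistxx.
  by exists r => // x xr; exact: rV.
by exists r => //; rewrite ballEmdist => -[x|//] xr; exact: rV.
Qed.

Lemma nbhs_metric_extension_Some (V : set metric_extension) (x : X) :
  nbhs (Some x : metric_extension) V <-> nbhs x (Some @^-1` V).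
Proof.
rewrite nbhs_ballP; split=> [[r r0]|/nb[r r0 rV]].
  rewrite ballEmdist => rV.
  have r2 : 0 < r / 2 by rewrite divr_gt0.
  have nd : nbhs x [set y | d x y < r / 2] by apply/nb; exists (r / 2).
  have nF : nbhs x [set y | `|F x - F y| < r / 2].
    by have /cvgrPdist_lt/(_ _ r2) := @F_cont x.
  apply: filterS (filterI nd nF) => y [/= dy Fy]; apply: rV => /=.
  rewrite /mdist/= gt_min; apply/orP; left; lra.
exists (Num.min r (F x)); first by rewrite /= lt_min r0 F_gt0.
rewrite ballEmdist => -[y|]; rewrite /mdist/= lt_min; last first.
  by rewrite ltxx andbF.
rewrite !gt_min => H; apply: rV => /=.
have := F_gt0 y; have := normr_ge0 (F x - F y) => ? ?.
by move: H => /andP[/orP[] ? /orP[] ?]; lra.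
Qed.

End Metric_extension.


Section Zero_set_lambda.
Variables (R : realType) (X bX : topologicalType) (e : X -> bX).
Hypothesis sce : stone_cech e.

(** A zero of g in bX makes X dense in the extension: it lies in the closure of
    {x | g x < r} for every r > 0. *)
Lemma zero_set_lambda (g : bX -> R) :
  metrizable R X ->
  continuous g -> (forall x, 0 < g (e x)) -> g @^-1` [set 0] !=set0 ->
  lambda_image e R (g @^-1` [set 0]).
Proof.
move=> [d [d0 dC tri nb]] cg g0 [y gy].
pose F x := g (e x).
have cF : continuous F.
  move=> x; apply: continuous_comp; last exact: cg.
  exact: (stone_cech_continuous sce).
pose M := metric_extension d0 dC tri g0.
have nS (V : set M) x : nbhs (Some x : M) V <-> nbhs x (Some @^-1` V).
  exact: nbhs_metric_extension_Some.
have nN (V : set M) : nbhs (None : M) V <->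
    V None /\ exists2 r, 0 < r & forall x, F x < r -> V (Some x).
  exact: nbhs_metric_extension_None.
have mM : metrizable R M.
  exists mdist; split.
  - move=> u v; split; [exact: mdist_positivity|move=> ->; exact: mdistxx].
  - exact: metric_sym.
  - by move=> u v w; exact: metric_triangle.
  - move=> u V; rewrite nbhs_ballP /nbhs_ball /nbhs_ball_/=.
    by split=> -[r r0 rV]; exists r => //; move: rV; rewrite ballEmdist.
have emM : embedding (Some : X -> M).
  split=> [x z []//|A]; split=> [oA|[B oB ->]].
    exists (Some @` A).
      rewrite openE => _ [x Ax <-]; apply/nS.
      apply: filterS (open_nbhs_nbhs (conj oA Ax)) => z Az; by exists z.
    by apply/seteqP; split=> [x Ax|x [z Az [<-]] //]; exists x.
  rewrite openE => x Bx; apply/nS; exact: open_nbhs_nbhs.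
have rM : range (Some : X -> M) = ~` [set (None : M)].
  apply/seteqP; split=> [u [z _ <-] zN|[z|] nz].
  - discriminate zN.
  - by exists z.
  - by case: nz.
have dM : dense (range (Some : X -> M)).
  move=> V [u Vu] oV; case: u Vu => [z|] Vu.
    by exists (Some z); split => //; exists z.
  have /nN[_ [r r0 rV]] : nbhs (None : M) V by exact: open_nbhs_nbhs.
  have or : open (g @^-1` [set s | s < r]).
    by apply: open_comp => [? _|]; [exact: cg|exact: open_lt].
  have yr : (g @^-1` [set s | s < r]) y by rewrite /= gy.
  have [_ [[z zr _] _]] := closure_trace sce or yr filterT.
  by exists (Some z); split; [exact: rV|exists z].
pose Y := @Build_one_point_extension R X M Some None mM emM rM dM.
exists Y; apply: lambda_zero_setE => //; exact: nN.
Qed.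

End Zero_set_lambda.

(** * The summands *)

(** Balls with centre in a countable dense set and radius 1/(n+1), kept when
    their closure in A is compact, cover A. *)
Lemma separable_sigma_compact (R : realType) (X : topologicalType) (A : set X) :
  metrizable R X -> locally_compact [set: X] -> closed A ->
  separable (set_type A) -> sigma_compact A.
Proof.
move=> mX lcX clA [D cD dD].
case: mX => d [d0 dC tri nb].
pose B (u : set_type A * nat) : set X :=
  A `&` closure [set y | d (set_val u.1) y < u.2.+1%:R^-1].
pose K u := if pselect (compact (B u)) then B u else set0.
have cK u : compact (K u).
  by rewrite /K; case: (pselect (compact (B u))) => b //=; exact: compact0.
have KA u : K u `<=` A.
  by rewrite /K; case: (pselect (compact (B u))) => b //= x [].
suff -> : A = \bigcup_(u in D `*` setT) K u.
  apply: bigcup_sigma_compact; first exact: countableX.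
  move=> u; exists (fun=> K u) => //.
  by apply/seteqP; split=> [x Kx|x [] //]; exists 0%N.
apply/seteqP; split=> [x Ax|x [u _ /KA//]].
have [L nL [cL clL]] := lcX x I.
have /(nb x L).1[r r0 rL] : nbhs x L.
  by move: nL; rewrite /within/=; apply: filterS => y; exact.
have r2 : 0 < r / 2 by rewrite divr_gt0.
have [n] := ltr_add_invr r2; rewrite add0r => nr.
pose W : set X := [set y | d x y < n.+1%:R^-1].
have oW : open W by exact: (metrizable_open_ball tri nb).
have oW' : open (set_val @^-1` W : set (set_type A)) by exists W.
have [|z [Wz Dz]] := dD _ _ oW'.
  by exists (exist _ x (mem_set Ax)); rewrite /W/= (d0 x x).2.
have zx : d (set_val z) x < n.+1%:R^-1 by rewrite dC.
exists (z, n) => //; rewrite /K.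
case: (pselect (compact (B (z, n)))) => [cB|[]] /=.
  by split=> //=; apply: subset_closure.
(* the ball around z has radius < r/2 and contains x, so it lies in L *)
apply: (subclosed_compact _ cL).
  by apply: closedI => //; exact: closed_closure.
move=> y [_ cly]; rewrite (closure_id L).1//; apply: closureS cly => w /= zw.
apply: rL => /=; apply: le_lt_trans (tri x (set_val z) w) _.
move: zx zw nr; rewrite (dC x (set_val z)) /=.
by move: n.+1%:R^-1 => s; lra.
Qed.

Section Index.
Variables (X : topologicalType) (I : choiceType) (Xi : I -> set X).
Hypothesis Xi_sum : direct_sum Xi.

Lemma direct_sum_index : exists ix : X -> I,
  (forall C : set I, open (ix @^-1` C)) /\
  (forall i, Xi i = ix @^-1` [set i]).
Proof.
have [[inj op] surj] := Xi_sum.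
set phi := fun u : {i : I & set_type (Xi i)} => _ in inj op surj.
have /choice[s sP] : forall x, exists u, phi u = x.
  move=> x; have [u _ ux] : range phi x.
    by rewrite surj.
  by exists u.
pose ix x := projT1 (s x).
have ixE u : ix (phi u) = projT1 u by rewrite /ix (inj _ _ (sP (phi u))).
exists ix; split.
  move=> C.
  have /op[B oB CB] : open [set u : {i & set_type (Xi i)} | C (projT1 u)].
    apply/sigT_openP => i /=; have [Ci|nCi] := pselect (C i).
      rewrite (_ : _ @^-1` _ = setT); first exact: openT.
      by apply/seteqP; split.
    rewrite (_ : _ @^-1` _ = set0); first exact: open0.
    by apply/seteqP; split.
  suff -> : ix @^-1` C = B by [].
  have BE u : B (phi u) = C (projT1 u).
    by have := congr1 (fun E => E u) CB.
  by apply/seteqP; split=> x; rewrite -(sP x) /= ixE BE.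
move=> i; apply/seteqP; split=> x.
  by move=> Xix; exact: (ixE (existT _ i (exist _ x (mem_set Xix)))).
by move=> <-; rewrite -[in X in _ X](sP x); exact: set_valP.
Qed.

End Index.

Lemma discrete_subspaceP (X : topologicalType) (A : set X) :
  open A ->
  discrete_space (set_type A) <-> forall x, A x -> open [set x].
Proof.
move=> oA; split=> [dA x Ax|dA U].
  have [B oB BE] := dA [set exist _ x (mem_set Ax)].
  suff -> : [set x] = A `&` B by exact: openI.
  apply/seteqP; split=> [y ->|y [Ay By]].
    split=> //; have : (set_val @^-1` B) (exist _ x (mem_set Ax) : set_type A).
      by rewrite BE.
    by [].
  have : (set_val @^-1` B) (exist _ y (mem_set Ay) : set_type A) by [].
  by rewrite BE => -[].
exists (set_val @` U).
  rewrite openE => _ [u Uu <-].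
  have ou := dA _ (set_valP u).
  by apply: filterS (open_nbhs_nbhs (conj ou erefl)) => y ->; exists u.
by apply/seteqP; split=> u; [move=> [v Uv /val_inj <-]|exists u].
Qed.

Lemma relative_interiorP (T : topologicalType) (A Z : set T) (q : T) :
  A q -> relative_interior A Z q <-> nbhs q [set y | A y -> Z y].
Proof.
move=> Aq; change (nbhs_subspace (q : subspace A) Z <-> within A (nbhs q) Z).
by rewrite nbhs_subspace_in.
Qed.

(** * Zero-sets of the remainder *)

Section Remainder_zero_sets.
Variables (R : realType) (X bX : topologicalType) (e : X -> bX).
Hypothesis sce : stone_cech e.
Hypothesis mX : metrizable R X.
Hypothesis lcX : locally_compact [set: X].
Variables (I : Type) (ix : X -> I).
Hypothesis ix_open : forall C : set I, open (ix @^-1` C).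
Hypothesis ix_sigma : forall i, sigma_compact (ix @^-1` [set i]).

Let csigma_remainder y : csigmaX e y -> remainder e y.
Proof.
by move=> sy [x _ xy]; apply: sy; rewrite -xy; exact: range_sub_sigmaX.
Qed.

Lemma remainder_zero_set (Z : set bX) :
  zero_sets R (remainder e) Z ->
  exists F : bX -> R, [/\ continuous F, forall y, 0 <= F y
    & Z = remainder e `&` F @^-1` [set 0]].
Proof.
move=> [f cf ->].
have oe : open (range e) := locally_compact_open_range sce lcX.
have [F [cF F0 FE]] := tietze_remainder sce oe cf.
by exists F; split => //; apply/seteqP; split=> y [ry /= fy]; split=> //;
  apply/FE.
Qed.

(** The function g of [lambda_zero_set] has no zero in X, so the points where it
    is positive in an open set V meet as many summands as V does. *)
Lemma lambda_interior (Z : set bX) :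
  lambda_image e R Z -> relative_interior (csigmaX e) (Z `\` sigmaX e) = set0.
Proof.
move=> [Y <-]; apply/seteqP; split=> // q intq.
have [g [cg g0 gE]] := lambda_zero_set sce Y.
have sq : csigmaX e q by have [] := nbhs_singleton intq.
move: intq => /(relative_interiorP _ sq).1 nq.
have [|V [oV Vq]] := interior_csigmaX sce ix_open cg nq sq.
  by move=> y Wy /Wy[+ _]; rewrite gE /= => ->.
move=> cV; apply: (csigmaX_uncountable_trace sce ix_sigma oV Vq sq).
by apply: sub_countable cV; apply: subset_card_le; apply: image_subset => x Vx.
Qed.

(** The hypothesis on C0 says that the summands with index outside of C0 are
    discrete.  F cuts out Z in the remainder; its zeros in X are removed by
    adding a function G that vanishes on the remainder. *)
Lemma interior_lambda (Z : set bX) (C0 : set I) :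
  countable C0 ->
  (forall A, A `<=` ~` (ix @^-1` C0) -> open A) ->
  zero_sets R (remainder e) Z -> Z !=set0 ->
  relative_interior (csigmaX e) (Z `\` sigmaX e) = set0 -> lambda_image e R Z.
Proof.
move=> cC0 dC0 zZ [y0 Zy0] intZ.
have [F [cF F0 ZE]] := remainder_zero_set zZ.
pose A := [set x | F (e x) = 0 /\ ~ C0 (ix x)].
have oA : open A by apply: dC0 => x [].
have oA' : open (~` A).
  have -> : ~` A = (ix @^-1` C0) `|` [set x | F (e x) <> 0 /\ ~ C0 (ix x)].
    apply/seteqP; split=> [x nA|x [Cx [] //|[Fx _] [] //]].
    have [Cx|nCx] := pselect (C0 (ix x)); [by left|right; split=> // Fx].
    exact: nA.
  by apply: openU; [exact: ix_open|apply: dC0 => x []].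
(* Otherwise the closure of A is a neighbourhood, contained in Z outside of
   sigma bX, of a point q outside of sigma bX. *)
have cA : countable (ix @` A).
  apply: contrapT => ncA.
  have [q [clq sq _]] := uncountable_escapes_sigmaX sce ix_open
    (@cst_continuous _ _ (1 : R)) (fun x _ => ltr01) ncA.
  suff : relative_interior (csigmaX e) (Z `\` sigmaX e) q by rewrite intZ.
  apply/relative_interiorP => //.
  have nq : ~ closure (e @` (~` A)) q.
    exact: (closure_clopen_disjoint R sce oA oA').
  have oq : open (~` closure (e @` (~` A))).
    by apply: closed_openC; exact: closed_closure.
  apply: (filterS _ (open_nbhs_nbhs (conj oq nq))) => y nclA' sy; split=> //.
  have : closure (e @` setT) y := closure_trace sce openT Logic.I.
  rewrite -(setUv A) image_setU closureU => -[clA|//].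
  rewrite ZE; split; first exact: csigma_remainder.
  apply/eqP; rewrite eq_le F0 andbT.
  by apply: (closure_le cF _ clA) => x [-> _].
have cC : countable (C0 `|` ix @` A).
  rewrite -bigcup2E; apply: bigcup_countable => // n _.
  by case: n => [|[|n]] /=.
have [G [cG G0 Gr Gpos]] := sigma_compact_zero_set R sce
  (locally_compact_open_range sce lcX)
  (countable_index_sigma_compact ix_sigma cC).
pose H y := F y + G y.
have cH : continuous H by move=> y; apply: cvgD; [exact: cF|exact: cG].
have H0 x : 0 < H (e x).
  have [Cx|nCx] := pselect ((C0 `|` ix @` A) (ix x)).
    by rewrite ltr_wpDl//; exact: Gpos.
  rewrite ltr_wpDr// lt_neqAle F0 andbT eq_sym; apply/eqP => Fx.
  have [Cx|nC0x] := pselect (C0 (ix x)); first by apply: nCx; left.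
  by apply: nCx; right; exists x.
have ZH : Z = H @^-1` [set 0].
  rewrite ZE; apply/seteqP; split=> y.
    by move=> [ry /= Fy]; rewrite /H Fy Gr// addr0.
  move=> /= Hy.
  have ry : remainder e y by move=> [x _ xy]; have := H0 x; rewrite xy Hy ltxx.
  by split=> //=; move: Hy; rewrite /H Gr// addr0.
by rewrite ZH; apply: zero_set_lambda => //; exists y0; rewrite -ZH.
Qed.

(** The zeros in X of the function g defining Z are one non-isolated point of
    each summand that has one. *)
Lemma uncountable_nonisolated_interior_not_lambda :
  ~ countable [set i | exists2 x, ix x = i & ~ open [set x]] ->
  exists Z : set bX,
    [/\ zero_sets R (remainder e) Z, Z !=set0,
      relative_interior (csigmaX e) (Z `\` sigmaX e) = set0
      & ~ lambda_image e R Z].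
Proof.
set J := [set i | _] => ncJ.
have [d [d0 dC tri nb]] := mX.
have dge0 x y : 0 <= d x y.
  have := tri x y x; rewrite (dC y x) (d0 x x).2 //; lra.
have cd x : continuous (d x).
  move=> y; apply/cvgrPdist_lt => r r0; apply/nb; exists r => // z /= yz.
  have := tri x y z; have := tri x z y; rewrite (dC z y) => ? ?.
  by rewrite ltr_norml; apply/andP; split; lra.
have /choice[h hP] : forall i, exists h : X -> R,
    [/\ continuous h, forall x, 0 <= h x <= 1,
      J i -> exists x, [/\ ix x = i, h x = 0, ~ open [set x] &
                        forall y, h y = 0 -> y = x]
      & ~ J i -> forall x, 0 < h x].
  move=> i; have [Ji|nJi] := pselect (J i); last first.
    exists (fun=> 1); split => //; first exact: cst_continuous.
    by move=> x; rewrite ler01 lexx.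
  have [x xi nx] := Ji; exists (fun y => Num.min (d x y) 1); split => //.
  - move=> y; apply: (@continuous_min _ _ (d x) (fun=> 1)); first exact: cd.
    exact: cst_continuous.
  - by move=> y; rewrite le_min dge0 ler01 ge_min lexx orbT.
  - move=> _; exists x; split => //.
      by rewrite (d0 x x).2//; apply/min_idPl; exact: ler01.
    move=> y; rewrite /Num.min; case: ifP => _ H; first by apply/esym/d0.
    by move: H => /eqP; rewrite oner_eq0.
pose F x := h (ix x) x.
have cF : continuous F.
  move=> x; have [ch _ _ _] := hP (ix x).
  have ox : nbhs x (ix @^-1` [set ix x]).
    by apply: open_nbhs_nbhs; split; [exact: ix_open|].
  apply: cvg_trans (ch x); apply: near_eq_cvg.
  by apply: filterS ox => y /= yx; rewrite /F yx.
have [|g [cg g01 gE]] := stone_cech_extend sce cF.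
  by move=> x; have [_ h01 _ _] := hP (ix x); exact: h01.
have g0 y : 0 <= g y by have /andP[] := g01 y.
pose S := [set x | F x = 0].
have ncS : ~ countable (ix @` S).
  apply: contra_not ncJ; apply: sub_countable; apply: subset_card_le => i Ji.
  have [_ _ /(_ Ji)[x [xi hx _ _]] _] := hP i.
  by exists x => //; rewrite /S/= /F xi.
have gS q : closure (e @` S) q -> g q = 0.
  move=> clq; apply/eqP; rewrite eq_le g0 andbT.
  by apply: (closure_le cg _ clq) => x; rewrite gE => ->.
exists (remainder e `&` g @^-1` [set 0]); split.
- by exists g => //; exact: continuous_subspaceT.
- have [q [clq sq _]] := uncountable_escapes_sigmaX sce ix_open
    (@cst_continuous _ _ (1 : R)) (fun x _ => ltr01) ncS.
  by exists q; split; [exact: csigma_remainder|exact: gS].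
- apply/seteqP; split=> // q intq.
  have sq : csigmaX e q by have [] := nbhs_singleton intq.
  move: intq => /(relative_interiorP _ sq).1 nq.
  have [|V [oV Vq]] := interior_csigmaX sce ix_open cg nq sq.
    by move=> y Wy /Wy[[_ /= ->]].
  move=> cV; apply: (csigmaX_uncountable_trace sce ix_sigma oV Vq sq).
  apply: sub_countable cV; apply: subset_card_le => _ [x Vx <-].
  (* if x is a zero of g, some other point of V in the summand of x is not,
     because x is not isolated *)
  have [F0|F0] := eqVneq (F x) 0; last first.
    exists x => //; split=> //; rewrite lt_neqAle g0 andbT eq_sym gE.
    exact: F0.
  have [_ _ hJ hnJ] := hP (ix x).
  have [Ji|/hnJ/(_ x)] := pselect (J (ix x)); last by rewrite -/(F x) F0 ltxx.
  have [z [zx hz nz zuniq]] := hJ Ji.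
  have xz := zuniq _ F0.
  apply: contrapT => nVx; apply: nz.
  suff -> : [set z] = (e @^-1` V) `&` (ix @^-1` [set ix x]).
    apply: openI; last exact: ix_open.
    by apply: open_comp => // y _; exact: (stone_cech_continuous sce).
  apply/seteqP; split=> [y ->|y [Vy yx]]; first by rewrite -xz.
  apply: contrapT => nyz; apply: nVx; exists y => //; split=> //.
  rewrite lt_neqAle g0 andbT eq_sym gE /F yx; apply/eqP => /zuniq.
  exact: nyz.
- move=> [Y YE]; have [g' [cg' g'0 g'E]] := lambda_zero_set sce Y.
  have [q [clq sq g'q]] := uncountable_escapes_sigmaX sce ix_open cg'
    (fun x _ => g'0 x) ncS.
  have : lambda e Y q.
    by rewrite YE; split; [exact: csigma_remainder|exact: gS].
  by rewrite g'E /= => g'q0; move: g'q; rewrite g'q0 ltxx.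
Qed.

End Remainder_zero_sets.

Theorem theorem2p1 (R : realType) (X bX : topologicalType) (e : X -> bX)
    (I : choiceType) (Xi : I -> set X) :
  metrizable R X -> locally_compact [set: X] -> ~ separable X ->
  stone_cech e ->
  direct_sum Xi ->
  (forall i, separable (set_type (Xi i))) ->
  (forall i, ~ compact [set: set_type (Xi i)]) ->
  (countable [set i | ~ discrete_space (set_type (Xi i))] ->
     forall Z : set bX, zero_sets R (remainder e) Z -> Z !=set0 ->
       lambda_image e R Z <->
       relative_interior (csigmaX e) (Z `\` sigmaX e) = set0) /\
  (~ countable [set i | ~ discrete_space (set_type (Xi i))] ->
     exists Z : set bX,
       [/\ zero_sets R (remainder e) Z, Z !=set0,
           relative_interior (csigmaX e) (Z `\` sigmaX e) = set0
         & ~ lambda_image e R Z]).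
Proof.
move=> mX lcX _ sce Xi_sum sepXi _.
have [ix [ix_open XiE]] := direct_sum_index Xi_sum.
have oXi i : open (Xi i) by rewrite XiE; exact: ix_open.
have ix_sigma i : sigma_compact (ix @^-1` [set i]).
  rewrite -XiE; apply: (separable_sigma_compact mX lcX) => //.
  rewrite XiE -[X in closed X]setCK; apply: open_closedC.
  exact: (ix_open (~` [set i])).
split.
  move=> cnd Z zZ Z0; split; first exact: lambda_interior.
  apply: (interior_lambda sce mX lcX ix_open ix_sigma cnd) => // A Adisc.
  rewrite openE => x Ax.
  have dx : discrete_space (set_type (Xi (ix x))).
    by apply: contrapT => nd; exact: (Adisc x Ax).
  have ox : open [set x].
    by apply: (discrete_subspaceP (oXi (ix x))).1 => //; rewrite XiE.
  by apply: (filterS _ (open_nbhs_nbhs (conj ox erefl))) => y ->.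
move=> ncnd.
apply: (uncountable_nonisolated_interior_not_lambda sce mX ix_open ix_sigma).
apply: contra_not ncnd; apply: sub_countable; apply: subset_card_le => i.
move=> /= nd; apply: contrapT => nx; apply: nd.
apply/(discrete_subspaceP (oXi i)) => x; rewrite XiE => xi.
by apply: contrapT => nox; apply: nx; exists x.
Qed.
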